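(* Let $d,n\in\mathbb{N}$ and let $u\colon\mathbb{Z}^d\to\mathbb{R}$ be a not identically vanishing single site potential with support contained in $\Lambda_{-n}=\{-n,\dots,0\}^d$. Then there exists a constant $c_u\in(0,\infty)$ depending only on $u$ such that, for the discrete alloy-type model $H_\omega=H_0+V_\omega$ with single site potential $u$ and coupling constants with density $f\in BV$, for all $L\in\mathbb{N}$, $E\in\mathbb{R}$ and $\epsilon>0$, \[ \mathbb{E}\left\{\mathrm{Tr}\big[\chi_{[E-\epsilon,E+\epsilon]}(H_{\omega,L})\big]\right\}\le c_u\,\mathrm{rank}\,u\,\|f\|_{BV}\,\epsilon\,(L+n)^{d\cdot(n+1)} . \]
   Context: $\mathbb{N}=\{1,2,\dots\}$. Discrete alloy-type model: $H_0$ is an arbitrary symmetric operator on $\ell^2(\mathbb{Z}^d)$ (with the finitely supported functions in its domain). The random potential $V_\omega$ is the multiplication operator by $V_\omega(x)=\sum_{k\in\mathbb{Z}^d}\omega_k\,u(x-k)$, where $(\omega_k)_{k\in\mathbb{Z}^d}$ are i.i.d. real random variables, each having a probability density $f$, and $u\colon\mathbb{Z}^d\to\mathbb{R}$ is the single site potential. $\mathbb{E}$ denotes expectation with respect to the product measure of the $\omega_k$. $BV$ denotes the space of functions on $\mathbb{R}$ of bounded total variation, and $\|f\|_{BV}$ is the total variation of $f$. $\mathrm{rank}\,u$ is the number of points in the support of $u$. For $L\in\mathbb{N}$ let $\Lambda_L=[0,L]^d\cap\mathbb{Z}^d$, let $\iota_L\colon\ell^2(\Lambda_L)\to\ell^2(\mathbb{Z}^d)$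 be the canonical inclusion and $\pi_L\colon\ell^2(\mathbb{Z}^d)\to\ell^2(\Lambda_L)$ its adjoint (restriction). The finite box restriction is the selfadjoint operator $H_{\omega,L}=\pi_LH_0\iota_L+V_\omega\chi_{\Lambda_L}$ on the finite dimensional space $\ell^2(\Lambda_L)$. $\chi_I$ is the indicator function of $I$, so $\mathrm{Tr}[\chi_I(H_{\omega,L})]$ is the number of eigenvalues of $H_{\omega,L}$ in $I$, counted with multiplicity. *)

(* Defs.v *)
From HB Require Import structures.
From mathcomp Require Import all_boot all_order all_algebra finmap.
From mathcomp Require Import all_classical all_reals all_analysis.
From mathcomp.real_closed Require Import complex.

Set Implicit Arguments.
Unset Strict Implicit.
Unset Printing Implicit Defensive.
Import Order.TTheory GRing.Theory Num.Theory.

Local Open Scope classical_set_scope.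
Local Open Scope ring_scope.
Local Open Scope complex_scope.

Notation Zd d := 'rV[int]_d.

Section Ell2.
Variables (R : realType) (I : choiceType).
Implicit Types (g : I -> R) (phi psi : I -> R[i]).

(* Sum of an absolutely summable family, through its positive and negative
   parts. *)
Definition rsum g : R :=
  fine (\esum_(x in [set: I]) (g^\+ x)%:E) -
  fine (\esum_(x in [set: I]) (g^\- x)%:E).

Definition csum psi : R[i] :=
  rsum (fun x => complex.Re (psi x)) +i* rsum (fun x => complex.Im (psi x)).

Definition ell2 : set (I -> R[i]) :=
  [set psi | summable [set: I] (fun x => (ComplexField.Normc.normc (psi x) ^+ 2)%:E)].

(* Antilinear in the first argument. *)
Definition ell2_inner phi psi : R[i] := csum (fun x => (phi x)^* * psi x).

(* [D] is the domain of [H]; the values of [H] outside [D] are irrelevant. *)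
Record symmetric_operator (D : set (I -> R[i]))
    (H : (I -> R[i]) -> (I -> R[i])) : Prop := SymmetricOperator {
  symop_dom_ell2 : D `<=` ell2 ;
  symop_ell2 : forall psi, D psi -> ell2 (H psi) ;
  symop_dom_linear : forall (a : R[i]) phi psi, D phi -> D psi ->
    D (fun x => a * phi x + psi x) ;
  symop_linear : forall (a : R[i]) phi psi, D phi -> D psi ->
    H (fun x => a * phi x + psi x) = (fun x => a * H phi x + H psi x) ;
  symop_dom_finite : forall psi, finite_set [set x | psi x != 0] -> D psi ;
  symop_symmetric : forall phi psi, D phi -> D psi ->
    ell2_inner (H phi) psi = ell2_inner phi (H psi) }.

End Ell2.

(* g(A) = U^* diag(g(lambda_1), ..., g(lambda_N)) U, where
   A = U^* diag(lambda_1, ..., lambda_N) U with U unitary; meaningful for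
   Hermitian A, whose eigenvalues lambda_i are real. *)
Definition funcalc (R : realType) (N : nat) (g : R -> R) (A : 'M[R[i]]_N) :
    'M[R[i]]_N :=
  invmx (spectralmx A) *m
  diag_mx (map_mx (fun z => (g (complex.Re z))%:C) (spectral_diag A)) *m
  spectralmx A.

(* Tr[chi_J(A)], which is real. *)
Definition trace_indic (R : realType) (N : nat) (J : set R) (A : 'M[R[i]]_N) :
    R :=
  complex.Re (\tr (funcalc (\1_J) A)).

Section Box.
Variables (d L : nat).

Definition box : set (Zd d) := [set x : Zd d | forall j, 0 <= x 0 j <= L%:Z].

Definition boxN : set (Zd d) := [set x : Zd d | forall j, - L%:Z <= x 0 j <= 0].

Definition box_card : nat := #|{: 'rV['I_L.+1]_d}|.

(* Enumeration of the points of [box]; see [box_pt_inj] and [box_pt_range]. *)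
Definition box_pt (i : 'I_box_card) : Zd d :=
  map_mx (fun k : 'I_L.+1 => (k : nat)%:Z) (enum_val i).

Lemma box_pt_inj : injective box_pt.
Proof.
move=> i j /rowP e; apply: enum_val_inj; apply/rowP => k.
by have := e k; rewrite !mxE => -[] /val_inj.
Qed.

Lemma box_pt_range : range box_pt = box.
Proof.
apply/seteqP; split=> [_ [i _ <-] j|x xb].
  by rewrite mxE /= lez_nat -ltnS ltn_ord.
pose y : 'rV['I_L.+1]_d := \row_j inord (absz (x 0 j)).
exists (enum_rank y) => //; apply/rowP => j; rewrite /box_pt enum_rankK !mxE.
have /andP[x0 xL] := xb j; rewrite inordK; first by rewrite gez0_abs.
by rewrite ltnS -lez_nat gez0_abs.
Qed.

Variable R : realType.

(* The column vector [v] represents the function on [box] whose value at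
   [box_pt i] is [v i 0]. *)
Definition box_incl (v : 'cV[R[i]]_box_card) : Zd d -> R[i] :=
  fun x => \sum_i (if x == box_pt i then v i 0 else 0).

Definition box_restr (psi : Zd d -> R[i]) : 'cV[R[i]]_box_card :=
  \col_i psi (box_pt i).

(* Matrix, in the canonical basis, of the compression to [box] of H0 + V. *)
Definition box_hamiltonian (H0 : (Zd d -> R[i]) -> (Zd d -> R[i]))
    (V : Zd d -> R) : 'M[R[i]]_box_card :=
  \matrix_(i, j) box_restr (H0 (box_incl (delta_mx j 0))) i 0 +
  diag_mx (\row_i (V (box_pt i))%:C).

End Box.

Section Potential.
Variables (R : realType) (d : nat).

(* For [u] of finite support the sum has finitely many nonzero terms. *)
Definition alloy_potential (u omega : Zd d -> R) : Zd d -> R :=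
  fun x => \sum_(k \in [set: Zd d]) omega k * u (x - k).

Definition pot_rank (u : Zd d -> R) : nat :=
  #|` fset_set [set x | u x != 0]|.

End Potential.

Section Density.
Variable R : realType.
Local Open Scope ereal_scope.

(* Total variation on the whole real line. *)
Definition BVnorm (f : R -> R) : \bar R :=
  ereal_sup [set total_variation ab.1 ab.2 f | ab in
    [set ab : R * R | (ab.1 <= ab.2)%R]].

Definition in_BV (f : R -> R) : Prop := BVnorm f < +oo.

Definition prob_density (f : R -> R) : Prop :=
  [/\ forall t, (0 <= f t)%R, measurable_fun [set: R] f &
      \int[lebesgue_measure]_t (f t)%:E = 1].

Definition has_density (dT : measure_display) (T : measurableType dT)
    (P : probability T R) (X : {RV P >-> R}) (f : R -> R) : Prop :=
  forall A : set R, measurable A ->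
    distribution P X A = \int[lebesgue_measure]_(t in A) (f t)%:E.

Definition mutually_independent (dT : measure_display) (T : measurableType dT)
    (P : probability T R) (I : choiceType) (X : I -> {RV P >-> R}) : Prop :=
  forall (J : {fset I}) (A : I -> set R), (forall i, measurable (A i)) ->
    P (\bigcap_(i in [set` J]) (X i @^-1` A i)) =
    \prod_(i <- J) P (X i @^-1` A i).

End Density.

(* Main.v *)
From HB Require Import structures.
Require Import Defs.
From mathcomp Require Import all_boot all_order all_algebra finmap.
From mathcomp Require Import all_classical all_reals all_analysis.
From mathcomp.real_closed Require Import complex.
From mathcomp Require Import measurable_realfun ring lra zify.

Set Implicit Arguments.
Unset Strict Implicit.
Unset Printing Implicit Defensive.
Import Order.TTheory GRing.Theory Num.Theory.
Import numFieldNormedType.Exports.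

Local Open Scope classical_set_scope.
Local Open Scope ring_scope.

(** Write N(A, E) for the number of eigenvalues of the Hermitian matrix A that
are at most E, H(w) for the box Hamiltonian with coupling constants w, and eps
for the half-width of the energy window.

The single site potential may change sign, so the eigenvalues need not be
monotone in any one coupling constant.  However, some combination of the
translates of u is constant.  Choose a multi-index J for which the moment of
p |-> u(-p) of order J is nonzero while the moments of all smaller multi-indices
vanish; one exists, with entries at most n, because the monomials with entries
at most n separate the points of the box of side n (interpolation).  Expanding
(x + p)^J shows that the sum over k of k^J u(x - k) does not depend on x
(sum_translated_monomial).  Dividing by the moment gives weights a_k with
H(w + t a) = H(w) + t on the box, hence N(H(w + t a), E) = N(H(w), E - t), and

  Tr chi_[E - eps, E + eps] (H(w)) <= N(H(w), E + eps) - N(H(w), E - 2 eps)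
                     = N(H(w - eps a), E) - N(H(w + 2 eps a), E).

The right-hand side is telescoped by moving the coupling constants one at a
time (shifted_mean_le).  A move of w_k changes the matrix by a perturbation of
rank at most rank u, so that N changes by at most rank u
(eig_count_diag_family_coord, a dimension count).  Conditionally on the other
coupling constants, the mean of a function of w_k with oscillation r changes by
at most r |s - s'| ||f||_BV when the shift of w_k goes from s to s': move the
shifts to the density and use that the integral of |f(t - s) - f(t - s')| is at
most |s - s'| ||f||_BV (integral_increment_le).  In total the mean of the trace is at most
3 eps (rank u) ||f||_BV sum_k |a_k|, and the sum, over the (L + n + 1)^d
relevant sites, of |a_k| <= (L + n)^(d n) / |moment| gives the power d (n + 1)
of L + n.

Two points need care.  The function w |-> N(H(w), E) is upper semicontinuous,
hence measurable.  The independence hypothesis, which concerns rectangles, is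
turned into a product law for (w_k, the other coordinates) by equipping the
probability space itself with the sigma-algebra of the other coordinates. *)

(** * Counting eigenvalues of Hermitian matrices *)

Section EigenvalueCount.
Variables (R : realType) (N : nat).
Local Notation C := R[i].
Local Notation "M ^t*" := (map_mx Num.conj (trmx M)) (at level 30).
Implicit Types (A : 'M[C]_N) (v : 'rV[C]_N).

Definition eigval A (i : 'I_N) : R := complex.Re (spectral_diag A 0 i).

Definition eig_count A (E : R) : nat := #|[pred i | eigval A i <= E]|.

Lemma hermitian_eigvalE A : A \is hermsymmx ->
  forall i, spectral_diag A 0 i = (eigval A i)%:C%C.
Proof.
move=> /hermitian_spectral_diag_real /mxOverP h i.
by rewrite /eigval RRe_real.
Qed.

Lemma hermitian_spectralE A : A \is hermsymmx ->
  spectralmx A *m A = diag_mx (spectral_diag A) *m spectralmx A.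
Proof.
move=> /hermitian_normalmx /orthomx_spectralP {2}->.
by rewrite !mulmxA mulmxV ?spectral_unit// mul1mx.
Qed.

Lemma sqnorm_unitary k (M : 'M[C]_(k, N)) (c : 'rV[C]_k) : M \is unitarymx ->
  (c *m M) *m (c *m M)^t* = c *m c^t*.
Proof.
move=> /unitarymxP MM.
by rewrite trmx_mul map_mxM mulmxA -(mulmxA c) MM mulmx1.
Qed.

Lemma rowsub_spectral_unitary A (k : nat) (g : 'I_k -> 'I_N) : injective g ->
  rowsub g (spectralmx A) \is unitarymx.
Proof.
move=> gi; apply/unitarymxP/matrixP => i j.
have /unitarymxP/matrixP/(_ (g i) (g j)) := spectral_unitarymx A.
rewrite !mxE (inj_eq gi) => <-.
by apply: eq_bigr => l _; rewrite !mxE.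
Qed.

(** The enumeration [g] selects eigenvectors, so that the form can be evaluated
on the span of those with eigenvalue below, or above, a given energy. *)
Lemma quadratic_form_spectral A (k : nat) (g : 'I_k -> 'I_N) (c : 'rV[C]_k) :
  A \is hermsymmx -> injective g ->
  let v := c *m rowsub g (spectralmx A) in
  (v *m A *m v^t*) 0 0 = \sum_i (eigval A (g i))%:C%C * `|c 0 i| ^+ 2.
Proof.
move=> hA gi v.
have -> : v *m A = c *m diag_mx (\row_i (eigval A (g i))%:C%C)
    *m rowsub g (spectralmx A).
  rewrite /v -!mulmxA; congr (_ *m _).
  rewrite mul_rowsub_mx hermitian_spectralE//; apply/matrixP => i j.
  by rewrite mxE mul_diag_mx mxE mul_diag_mx !mxE hermitian_eigvalE.
have /unitarymxP U := rowsub_spectral_unitary A gi.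
rewrite /v trmx_mul map_mxM mulmxA -(mulmxA _ (rowsub _ _)) U mulmx1 mxE.
by apply: eq_bigr => i _; rewrite mul_mx_diag !mxE normCK; ring.
Qed.

Lemma sqnormE k (c : 'rV[C]_k) : (c *m c^t*) 0 0 = \sum_i `|c 0 i| ^+ 2.
Proof. by rewrite mxE; apply: eq_bigr => i _; rewrite !mxE normCK. Qed.

Lemma hermitian_addr_diag A (e : 'I_N -> R) : A \is hermsymmx ->
  A + diag_mx (\row_i (e i)%:C%C) \is hermsymmx.
Proof.
move=> /is_hermitianmxP hA; apply/is_hermitianmxP.
rewrite !expr0 !scale1r in hA *.
rewrite raddfD/= map_mxD -hA; congr (_ + _).
apply/matrixP => i j; rewrite !mxE [j == i]eq_sym.
case: (i =P j) => [->|_]; last by rewrite !mulr0n raddf0.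
rewrite !mulr1n; apply/esym/(@conj_Creal C)/complex_realP; by exists (e j).
Qed.

(** A vector that is at once in the span of the eigenvectors of [A + diag e]
with eigenvalue at most [E], in the span of those of [A] with eigenvalue above
[E + s], and vanishes at the at most [r] indices with [e i < - s] must be zero,
since its quadratic forms contradict each other; comparing dimensions gives the
bound.  The three uses are [s] arbitrary with [r = 0] (shifts and
semicontinuity) and [s = 0] (perturbations of rank [r]). *)
Lemma eig_count_perturbation A (e : 'I_N -> R) (s E : R) (r : nat) :
  A \is hermsymmx -> (#|[pred i | (e i < - s)%R]| <= r)%N ->
  (eig_count (A + diag_mx (\row_i (e i)%:C%C)) E <= eig_count A (E + s) + r)%N.
Proof.
move=> hA er; set B := A + _.
have hB : B \is hermsymmx by exact: hermitian_addr_diag.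
pose pB := [pred i | eigval B i <= E].
pose pA := [pred i | ~~ (eigval A i <= E + s)].
pose pe := [pred i | e i < - s].
pose MB := rowsub (@enum_val _ pB) (spectralmx B).
pose MA := rowsub (@enum_val _ pA) (spectralmx A).
pose K := colsub (@enum_val _ pe) (1%:M : 'M[C]_N).
have rB : \rank MB = #|pB|.
  by apply/mxrank_unitary/rowsub_spectral_unitary/enum_val_inj.
have rA : \rank MA = #|pA|.
  by apply/mxrank_unitary/rowsub_spectral_unitary/enum_val_inj.
have rK : (N <= \rank (kermx K) + r)%N.
  have := leq_trans (rank_leq_col K) er.
  rewrite mxrank_ker; lia.
have cA : (#|pA| + eig_count A (E + s) = N)%N.
  by rewrite addnC /eig_count cardC card_ord.
suff disj : ((MB :&: kermx K) :&: MA = 0)%MS.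
  (* Each of the two sums of subspaces has dimension at most N. *)
  have sum1 := mxrank_sum_cap MB (kermx K).
  have := mxrank_sum_cap (MB :&: kermx K)%MS MA.
  rewrite disj mxrank0 addn0 => sum2; rewrite rB in sum1; rewrite rA in sum2.
  have le1 := rank_leq_col (MB + kermx K)%MS.
  have le2 := rank_leq_col ((MB :&: kermx K) + MA)%MS.
  rewrite /eig_count -/pB in cA *.
  move: rK cA sum1 sum2 le1 le2.
  move: (\rank _) (\rank _) (\rank _) (\rank _) => k x y z.
  move: #|pA| #|pB| #|_| => a b c.
  lia.
apply/eqP; rewrite -submx0; apply/rV_subP => v.
rewrite !sub_capmx submx0 => /andP[/andP[/submxP[b vb] /sub_kermxP vK]].
move=> /submxP[a va].
have qB := quadratic_form_spectral b hB (@enum_val_inj _ pB).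
have qA := quadratic_form_spectral a hA (@enum_val_inj _ pA).
have nB := sqnorm_unitary b (rowsub_spectral_unitary B (@enum_val_inj _ pB)).
have nA := sqnorm_unitary a (rowsub_spectral_unitary A (@enum_val_inj _ pA)).
rewrite /= -/MB -/MA -vb -va in qA qB nA nB.
have vpe i : pe i -> v 0 i = 0.
  move=> pi; have /rowP/(_ (enum_rank_in pi i)) := vK.
  rewrite !mxE (bigD1 i)//= big1 ?addr0.
    by rewrite !mxE enum_rankK_in// eqxx mulr1.
  by move=> j ji; rewrite !mxE enum_rankK_in// (negPf ji) mulr0.
have qBA : (v *m B *m v^t*) 0 0 = (v *m A *m v^t*) 0 0 +
    \sum_i (e i)%:C%C * `|v 0 i| ^+ 2.
  rewrite mulmxDr mulmxDl mxE; congr (_ + _); rewrite mxE.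
  by apply: eq_bigr => i _; rewrite mul_mx_diag !mxE normCK; ring.
have nBE : (v *m v^t*) 0 0 = \sum_i `|b 0 i| ^+ 2 by rewrite nB sqnormE.
have nAE : (v *m v^t*) 0 0 = \sum_i `|a 0 i| ^+ 2 by rewrite nA sqnormE.
have leB : (v *m B *m v^t*) 0 0 <= E%:C%C * (v *m v^t*) 0 0.
  rewrite qB nBE mulr_sumr; apply: ler_sum => i _.
  by apply: ler_wpM2r; rewrite ?exprn_ge0// lecR; exact: (enum_valP i).
have lee : - s%:C%C * (v *m v^t*) 0 0 <= \sum_i (e i)%:C%C * `|v 0 i| ^+ 2.
  rewrite sqnormE mulr_sumr; apply: ler_sum => i _.
  have [/vpe ->|] := boolP (pe i); first by rewrite normr0 expr0n !mulr0.
  rewrite -leNgt => h; apply: ler_wpM2r; rewrite ?exprn_ge0//.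
  by rewrite -rmorphN lecR.
(* The bounds on v force a sum of nonnegative terms to be at most 0. *)
have : \sum_i (eigval A (enum_val i) - (E + s))%:C%C * `|a 0 i| ^+ 2 <= 0.
  under eq_bigr do rewrite rmorphB mulrBl.
  rewrite sumrB -mulr_sumr -qA -nAE rmorphD/= subr_le0 mulrDl -lerBlDr.
  by rewrite -mulNr (le_trans _ leB)// qBA lerD2l.
have a0 i : 0 < (eigval A (@enum_val _ pA i) - (E + s))%:C%C.
  by rewrite ltcR subr_gt0 ltNge; exact: (enum_valP i).
move=> sum_le0; have sum0 : forall i, a 0 i = 0.
  move=> i; have t_ge0 j : true -> 0 <=
      (eigval A (@enum_val _ pA j) - (E + s))%:C%C * `|a 0 j| ^+ 2.
    by move=> _; rewrite mulr_ge0 ?exprn_ge0// ltW.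
  have := psumr_eq0P t_ge0 (le_anti _) (i := i) isT.
  rewrite sum_le0 sumr_ge0// => /(_ isT)/eqP.
  by rewrite mulf_eq0 gt_eqF//= expf_eq0/= normr_eq0 => /eqP.
by rewrite va (_ : a = 0) ?mul0mx//; apply/rowP => i; rewrite mxE.
Qed.

End EigenvalueCount.

Lemma trace_indicE (R : realType) (N : nat) (J : set R) (A : 'M[R[i]]_N) :
  trace_indic J A = \sum_i \1_J (eigval A i).
Proof.
rewrite /trace_indic /funcalc mxtrace_mulC mulmxA mulmxV ?spectral_unit// mul1mx.
rewrite mxtrace_diag; under eq_bigr do rewrite mxE.
by rewrite -[X in complex.Re X](rmorph_sum (real_complex R)).
Qed.

Lemma eig_countE (R : realType) (N : nat) (A : 'M[R[i]]_N) (E : R) :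
  (eig_count A E)%:R = \sum_i (eigval A i <= E)%R%:R :> R.
Proof.
rewrite /eig_count -sum1_card natr_sum big_mkcond/=.
by apply: eq_bigr => i _; rewrite inE; case: (_ <= _)%R.
Qed.

Lemma trace_indic_ge0 (R : realType) (N : nat) (J : set R) (A : 'M[R[i]]_N) :
  0 <= trace_indic J A.
Proof. by rewrite trace_indicE sumr_ge0// => i _; rewrite indicE. Qed.

Lemma trace_indic_le_count (R : realType) (N : nat) (A : 'M[R[i]]_N)
    (a a' b : R) : a' < a -> a <= b ->
  trace_indic `[a, b]%classic A + (eig_count A a')%:R <= (eig_count A b)%:R.
Proof.
move=> aa' ab; rewrite trace_indicE !eig_countE -big_split/=.
apply: ler_sum => i _; rewrite indicE; case: (boolP (_ \in _)).
  rewrite inE/= in_itv/= => /andP[h ->].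
  have -> : (eigval A i <= a') = false.
    by apply/negbTE; rewrite -ltNge (lt_le_trans aa').
  by rewrite addr0.
move=> _; rewrite add0r ler_nat; case: (leP _ a') => // h.
by rewrite (le_trans h)// (le_trans (ltW aa')).
Qed.

(** * Diagonal families *)

Section DiagonalFamily.
Variables (R : realType) (N m : nat) (A : 'M[R[i]]_N) (C : 'I_m -> 'I_N -> R).
Hypothesis hA : A \is hermsymmx.
Implicit Types (y a : 'I_m -> R).

Definition diag_family y : 'M[R[i]]_N :=
  A + diag_mx (\row_i (\sum_j y j * C j i)%:C%C).

Lemma eig_count_diag_family y y' (s E : R) (r : nat) :
  (#|[pred i | (\sum_j (y' j - y j) * C j i < - s)%R]| <= r)%N ->
  (eig_count (diag_family y') E <= eig_count (diag_family y) (E + s) + r)%N.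
Proof.
move=> yr.
have -> : diag_family y' = diag_family y +
    diag_mx (\row_i (\sum_j (y' j - y j) * C j i)%:C%C).
  rewrite /diag_family -addrA -raddfD/=; congr (_ + diag_mx _).
  apply/rowP => i; rewrite !mxE -rmorphD/= -big_split/=; congr (_%:C)%C.
  by apply: eq_bigr => j _; rewrite -mulrDl addrC subrK.
by apply: eig_count_perturbation => //; exact: hermitian_addr_diag.
Qed.

(** Along the direction [a] the family moves by multiples of the identity, so
shifting the parameters amounts to shifting the energy. *)
Lemma eig_count_diag_family_shift y a (t E : R) :
  (forall i, \sum_j a j * C j i = 1) ->
  eig_count (diag_family (fun j => y j + t * a j)) E =
  eig_count (diag_family y) (E - t).
Proof.
move=> a1.
have e i : \sum_j (y j + t * a j - y j) * C j i = t.
  rewrite -[RHS]mulr1 -(a1 i) mulr_sumr; apply: eq_bigr => j _.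
  ring.
have e' i : \sum_j (y j - (y j + t * a j)) * C j i = - t.
  by rewrite -[in RHS](e i) -sumrN; apply: eq_bigr => j _; ring.
apply/eqP; rewrite eqn_leq; apply/andP; split.
  rewrite -[leqRHS]addn0; apply: eig_count_diag_family.
  by rewrite leqn0; apply/eqP/eq_card0 => i; rewrite !inE e opprK ltxx.
rewrite -[X in (_ <= eig_count _ X)%N](subrK t) -[leqRHS]addn0.
apply: eig_count_diag_family.
by rewrite leqn0; apply/eqP/eq_card0 => i; rewrite !inE e' ltxx.
Qed.

(** Changing one parameter is a perturbation whose rank is at most the number
of diagonal entries that the parameter touches. *)
Lemma eig_count_diag_family_coord y y' (k : 'I_m) (E : R) :
  (forall j, j != k -> y' j = y j) ->
  (eig_count (diag_family y') E <=
   eig_count (diag_family y) E + #|[pred i | (C k i != 0)%R]|)%N.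
Proof.
move=> yy'; rewrite -[X in eig_count (diag_family y) X]addr0.
apply: eig_count_diag_family.
apply: fintype.subset_leq_card; apply/fintype.subsetP => i.
rewrite !inE oppr0 (bigD1 k)//= big1 ?addr0.
  by apply: contraTneq => ->; rewrite mulr0 ltxx.
by move=> j jk; rewrite yy'// subrr mul0r.
Qed.

(** The spectrum is finite, hence leaves a gap to the right of [E]. *)
Lemma eig_count_right_gap (B : 'M[R[i]]_N) (E : R) :
  exists2 s : R, 0 < s & eig_count B (E + s) = eig_count B E.
Proof.
pose s := \big[Num.min/1]_(i | E < eigval B i) ((eigval B i - E) / 2).
have s0 : 0 < s.
  apply: (big_ind (fun x => 0 < x)) => //.
    by move=> x y x0 y0; rewrite lt_min x0.
  by move=> i Ei; rewrite divr_gt0// subr_gt0.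
exists s => //; apply: eq_card => i; rewrite !inE.
case: (leP _ E) => Ei; first by rewrite (le_trans Ei)// lerDl ltW.
apply/negbTE; rewrite -ltNge -ltrBrDl.
have : s <= (eigval B i - E) / 2 by exact: bigmin_le_cond.
move=> /le_lt_trans; apply.
have := Ei; lra.
Qed.

(** If no eigenvalue lies in the interval from [E] to [E + s], a diagonal
perturbation of size less than [s] brings no new eigenvalue below [E]. *)
Lemma eig_count_diag_family_usc y (E : R) : exists2 r : R, 0 < r &
  forall y', (forall j, `|y' j - y j| < r) ->
  (eig_count (diag_family y') E <= eig_count (diag_family y) E)%N.
Proof.
have [s s0 sE] := eig_count_right_gap (diag_family y) E.
(* The leading 1 only ensures that M is positive. *)
pose M := 1 + \sum_j \sum_i `|C j i|.
have M0 : 0 < M by rewrite ltr_pwDl// !sumr_ge0// => j _; rewrite sumr_ge0.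
exists (s / M); first exact: divr_gt0.
move=> y' yy'; rewrite -[leqRHS]addn0 -sE; apply: eig_count_diag_family.
rewrite leqn0; apply/eqP/eq_card0 => i; rewrite !inE; apply/negbTE.
rewrite -leNgt lerNl (le_trans (ler_norm _))// normrN.
rewrite (le_trans (ler_norm_sum _ _ _))//.
have -> : s = \sum_j s / M * \sum_i `|C j i| + s / M.
  by rewrite -mulr_sumr -[X in _ + X]mulr1 -mulrDr addrC -/M divfK// gt_eqF.
rewrite -[leLHS]addr0; apply: lerD; last by rewrite divr_ge0 ?ltW.
apply: ler_sum => j _; rewrite normrM; apply: ler_pM => //.
  exact: ltW.
by rewrite (bigD1 i)//= lerDl sumr_ge0.
Qed.

End DiagonalFamily.

(** * Translates of functions of bounded variation *)

Section Translation.
Variable R : realType.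
Local Notation mu := (@lebesgue_measure R).
Local Open Scope ereal_scope.

Lemma measurable_addr (c : R) :
  measurable_fun [set: measurableTypeR R]
    (fun x : measurableTypeR R => x + c : measurableTypeR R)%R.
Proof. exact: measurable_funD. Qed.

Lemma measurable_translate d (T : measurableType d) (f : R -> T) (c : R) :
  measurable_fun [set: R] f -> measurable_fun [set: R] (fun x => f (x + c)%R).
Proof. by move=> mf; apply: (measurableT_comp mf); exact: measurable_addr. Qed.

Lemma lebesgue_measure_translate (c : R) (A : set R) : measurable A ->
  mu ((fun x => x + c)%R @^-1` A) = mu A.
Proof.
move=> mA; apply/esym.
pose T (x : measurableTypeR R) : measurableTypeR R := (x + c)%R.
have mT : measurable_fun setT T := measurable_addr c.
pose Tm : {mfun measurableTypeR R >-> measurableTypeR R} :=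
  HB.pack T (isMeasurableFun.Build _ _ _ _ T mT).
apply: (@lebesgue_measure_unique R (pushforward mu Tm)) => // _ [[a b]] _ <-.
change (mu `]a, b]%classic = mu (T @^-1` `]a, b]%classic)).
have -> : T @^-1` `]a, b]%classic = `](a - c)%R, (b - c)%R]%classic.
  by apply/seteqP; split=> x /=; rewrite !in_itv/= ltrBlDr lerBrDr.
rewrite !lebesgue_measure_itv/= !lte_fin ltrD2r.
by case: ifP => // _; rewrite -!EFinD; congr _%:E; ring.
Qed.

Lemma ge0_integral_translate (f : R -> \bar R) (c : R) (D : set R) :
  measurable D -> measurable_fun D f -> (forall x, D x -> 0 <= f x) ->
  \int[mu]_(x in (fun x => x + c)%R @^-1` D) f (x + c)%R = \int[mu]_(x in D) f x.
Proof.
move=> mD mf f0.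
pose T (x : measurableTypeR R) : measurableTypeR R := (x + c)%R.
have mT : measurable_fun setT T := measurable_addr c.
pose Tm : {mfun measurableTypeR R >-> measurableTypeR R} :=
  HB.pack T (isMeasurableFun.Build _ _ _ _ T mT).
transitivity (\int[pushforward mu Tm]_(x in D) f x).
  by rewrite ge0_integral_pushforward// => x /[!inE] /f0.
by apply: eq_measure_integral => A mA _; exact: lebesgue_measure_translate.
Qed.

End Translation.

Section BVTranslation.
Variables (R : realType) (f : R -> R) (V : R).
Local Notation mu := (@lebesgue_measure R).
Hypothesis mf : measurable_fun [set: R] f.
Hypothesis fV : forall a b, a <= b -> (total_variation a b f <= V%:E)%E.
Local Open Scope ereal_scope.

Lemma sum_increments_le_total_variation (h t : R) (n : nat) : (0 <= h)%R ->
  (\sum_(i < n) `|f (t + i.+1%:R * h) - f (t + i%:R * h)|)%R%:E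
  <= total_variation t (t + n%:R * h)%R f.
Proof.
move=> h0; elim: n => [|n IH].
  by rewrite big_ord0 mul0r addr0 total_variationxx.
have le1 : (t <= t + n%:R * h)%R by rewrite lerDl mulr_ge0.
have le2 : (t + n%:R * h <= t + n.+1%:R * h)%R.
  by rewrite lerD2l ler_wpM2r// ler_nat.
rewrite big_ord_recr/= EFinD (total_variationD f le1 le2).
by apply: leeD => //; exact: total_variation_ge.
Qed.

Let g (h t : R) : \bar R := `|f (t + h) - f t|%:E.

Let mg h (D : set R) : measurable_fun D (g h).
Proof.
apply/measurable_funTS/measurable_EFinP/measurableT_comp => //.
by apply: measurable_realfun.measurable_funB => //; exact: measurable_translate.
Qed.

Let mgt h c (D : set R) : measurable_fun D (fun t => g h (t + c)%R).
Proof. by apply: measurable_funTS; apply: measurable_translate; exact: mg. Qed.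

Let g0 h t : 0 <= g h t. Proof. by rewrite lee_fin. Qed.

(** Cut the interval into [n] pieces of length [h] and translate them all onto
the first one.  For fixed [t] the increments over the points
[t, t + h, ..., t + n h] sum to at most the total variation [V], and the first
piece has length [h]. *)
Lemma integral_increment_itv_le (a h : R) (n : nat) : (0 <= h)%R ->
  \int[mu]_(t in `[a, (a + n%:R * h)%R[) g h t <= h%:E * V%:E.
Proof.
move=> h0.
have -> : \int[mu]_(t in `[a, (a + n%:R * h)%R[) g h t =
    \sum_(i < n) \int[mu]_(t in `[a, (a + h)%R[) g h (t + i%:R * h)%R.
  elim: n => [|n IH].
    by rewrite big_ord0 mul0r addr0 set_itvco0 integral_set0.
  have le1 : (a <= a + n%:R * h)%R by rewrite lerDl mulr_ge0.
  have le2 : (a + n%:R * h <= a + n.+1%:R * h)%R.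
    by rewrite lerD2l ler_wpM2r// ler_nat.
  rewrite big_ord_recr/= -IH.
  rewrite (@itv_bndbnd_setU _ _ (BLeft a) (BLeft (a + n%:R * h)%R)) ?bnd_simp//.
  rewrite ge0_integral_setU//=; [|exact: mg|].
  2: by apply/disj_setPLR => x /=; rewrite !in_itv/= => /andP[_ xl] /andP[];
    rewrite leNgt xl.
  congr (_ + _).
  rewrite -(@ge0_integral_translate _ (g h) (n%:R * h))//.
  congr (integral _ _ _); apply/seteqP; split=> x /=; rewrite !in_itv/= lerD2r;
    by rewrite -natr1 mulrDl mul1r addrA (addrAC a) ltrD2r.
rewrite -ge0_integral_sum//; last first.
  by move=> i; exact: mgt.
have -> : h%:E * V%:E = \int[mu]_(t in `[a, (a + h)%R[) (cst V%:E) t.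
  rewrite integral_cst//= lebesgue_measure_itv/= lte_fin ltrDl.
  case: ltP => [_|]; first by rewrite -EFinD addrAC subrr add0r muleC.
  by move=> h0'; rewrite (@le_anti _ _ h 0%R) ?h0 ?h0'// mul0e mule0.
apply: ge0_le_integral => //.
- by move=> t _; apply: sume_ge0.
- apply: emeasurable_sum => i; exact: mgt.
move=> t _; rewrite sumEFin.
have le1 : (t <= t + n%:R * h)%R by rewrite lerDl mulr_ge0.
apply: le_trans (fV le1).
apply: le_trans (sum_increments_le_total_variation t n h0).
rewrite lee_fin; apply: ler_sum => i _.
by rewrite -addrA -natr1 mulrDl mul1r.
Qed.

Lemma integral_increment_le_pos (h : R) : (0 < h)%R ->
  \int[mu]_t g h t <= h%:E * V%:E.
Proof.
move=> h0.
pose F (n : nat) : set R := `[- (n%:R * h), n%:R * h[%classic%R.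
have FT : \bigcup_n F n = setT.
  rewrite -subTset => x _; pose n := (Num.truncn (`|x| / h)).+1.
  exists n => //; rewrite /F/= in_itv/=.
  have : (`|x| < n%:R * h)%R by rewrite -ltr_pdivrMr// truncnS_gt.
  by rewrite ltr_norml => /andP[/ltW -> ->].
have Fnd : nondecreasing_seq F.
  move=> m n mn; rewrite subsetEset; apply: subset_itv; rewrite bnd_simp.
    by rewrite lerN2 ler_wpM2r ?(ltW h0)// ler_nat.
  by rewrite ler_wpM2r ?(ltW h0)// ler_nat.
have : \int[mu]_(t in F n) g h t @[n --> \oo] -->
    \int[mu]_(t in \bigcup_n F n) g h t.
  apply: ge0_nondecreasing_set_cvg_integral => [//|i|i|i x _].
  - exact: measurable_itv.
  - exact: mg.
  - exact: g0.
rewrite FT => /cvg_lim <-//; apply: lime_le.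
  apply: ereal_nondecreasing_is_cvgn.
  apply: ge0_nondecreasing_set_nondecreasing_integral => [//|i|i|i x _].
  - exact: measurable_itv.
  - exact: mg.
  - exact: g0.
near=> n.
have := integral_increment_itv_le (- (n%:R * h)) (n + n) (ltW h0).
by rewrite natrD mulrDl addrA addNr add0r.
Unshelve. all: by end_near. Qed.

(** The translation modulus of [f] in L1 is controlled by its variation:
reduce to a positive increment and exhaust the line by intervals. *)
Lemma integral_increment_le (c c' : R) :
  \int[mu]_t `|f (t + c) - f (t + c')|%:E <= `|c - c'|%:E * V%:E.
Proof.
have mgc u v : measurable_fun setT (fun t : R => `|f (t + u) - f (t + v)|%:E).
  apply/measurable_EFinP/measurableT_comp => //.
  by apply: measurable_realfun.measurable_funB => //; exact: measurable_translate.
wlog cc : c c' / (c' <= c)%R.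
  move=> H; have [/H//|/ltW/H] := leP c' c.
  rewrite distrC; under eq_integral do rewrite distrC; exact.
have := cc; rewrite le_eqVlt => /predU1P[<-|c'c].
  rewrite subrr normr0 mul0e; under eq_integral do rewrite subrr normr0.
  by rewrite integral0.
pose F t := `|f (t + c) - f (t + c')|%:E.
rewrite -(@ge0_integral_translate _ F (- c') setT)//; last 2 first.
- exact: mgc.
- by move=> t _; rewrite lee_fin.
rewrite preimage_setT /F; under eq_integral do rewrite subrK addrAC -addrA.
rewrite ger0_norm ?subr_ge0//; apply: integral_increment_le_pos.
by rewrite subr_gt0.
Qed.

End BVTranslation.

(** * Shifting the argument of a density *)

Section Density.
Variable R : realType.
Local Notation mu := (@lebesgue_measure R).
Local Open Scope ereal_scope.

Variables (f : R -> R) (V : R).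
Hypotheses (f0 : forall t, (0 <= f t)%R) (mf : measurable_fun [set: R] f).

(** For integer-valued bounded [G] the change of variables reduces to finitely
many level sets, on which it is the definition of a density. *)
Lemma ge0_integral_density (m : {measure set R -> \bar R}) (G : R -> nat)
    (N : nat) :
  (forall A, measurable A -> m A = \int[mu]_(t in A) (f t)%:E) ->
  (forall k, measurable [set t | (k < G t)%N]) -> (forall t, (G t <= N)%N) ->
  \int[m]_t (G t)%:R%:E = \int[mu]_t ((G t)%:R * f t)%:E.
Proof.
move=> mE mG GN.
have GE t : (G t)%:R = (\sum_(k < N) \1_[set t | (k < G t)%N] t)%R :> R.
  rewrite -(big_mkord xpredT (fun k => \1_[set t | (k < G t)%N] t : R)).
  rewrite (big_cat_nat (n := G t))//= big_nat (eq_bigr (fun=> 1%R)); last first.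
    by move=> k /andP[_ kG]; rewrite indicE mem_set.
  rewrite -big_nat sumr_const_nat subn0 big_nat big1 ?addr0// => k /andP[kG _].
  by rewrite indicE memNset//=; apply/negP; rewrite -leqNgt.
transitivity (\int[m]_t \sum_(k < N) (\1_[set t | (k < G t)%N] t)%:E).
  by apply: eq_integral => t _; rewrite GE sumEFin.
rewrite ge0_integral_sum//; last first.
  by move=> k; apply/measurable_EFinP; exact: measurable_indic.
transitivity (\int[mu]_t \sum_(k < N) (\1_[set t | (k < G t)%N] t * f t)%:E);
    last first.
  by apply: eq_integral => t _; rewrite GE mulr_suml sumEFin.
rewrite ge0_integral_sum//; last 2 first.
- move=> k; apply/measurable_EFinP/measurable_realfun.measurable_funM => //.
  by apply: measurable_indic; exact: mG.
- by move=> k t _; rewrite lee_fin mulr_ge0.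
apply: eq_bigr => k _; rewrite integral_indic// setIT mE// [LHS]integral_mkcond.
apply: eq_integral => t _; rewrite patchE indicE.
by case: ifP => _; rewrite ?mul1r ?mul0r.
Qed.

Hypothesis f1 : \int[mu]_t (f t)%:E = 1.
Hypothesis fV : forall a b, (a <= b)%R -> (total_variation a b f <= V%:E).

(** After translation both integrals are integrals of the same [G] against
translates of [f].  Subtracting the minimum of [G] costs the same constant on
both sides because the translates of [f] have the same mass, and leaves a
function with values between 0 and [r]. *)
Lemma integral_density_shift (G : R -> nat) (r : nat) (s s' : R) :
  measurable_fun [set: R] (fun t => (G t)%:R : R) ->
  (forall t t', (G t <= G t' + r)%N) ->
  \int[mu]_t ((G (t + s))%:R * f t)%:E <=
  \int[mu]_t ((G (t + s'))%:R * f t)%:E + (r%:R * (`|s - s'| * V))%:E.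
Proof.
move=> mG Gr.
have shiftE c : \int[mu]_t ((G (t + c))%:R * f t)%:E =
    \int[mu]_t ((G t)%:R * f (t - c))%:E.
  pose F t := ((G (t + c))%:R * f t)%:E.
  rewrite -(@ge0_integral_translate _ F (- c) setT)//; last 2 first.
  - apply/measurable_EFinP/measurable_realfun.measurable_funM => //.
    exact: (@measurable_translate _ _ _ (fun t => (G t)%:R : R)).
  - by move=> t _; rewrite lee_fin mulr_ge0.
  by rewrite preimage_setT /F; under eq_integral do rewrite subrK.
have [t0 Gt0] : exists t0, forall t, (G t0 <= G t)%N.
  have ex : exists n, `[< exists t, G t = n >].
    by exists (G 0%R); apply/asboolP; exists 0%R.
  have [n /asboolP[t0 <-] nmin] := ex_minnP ex.
  by exists t0 => t; apply: nmin; apply/asboolP; exists t.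
pose c0 := G t0.
pose H t := (G t - c0)%N.
have GE t : (G t)%:R = (c0%:R + (H t)%:R)%R :> R by rewrite -natrD subnKC// Gt0.
have Hr t : ((H t)%:R <= r%:R :> R)%R by rewrite ler_nat leq_subLR Gr.
have mH : measurable_fun [set: R] (fun t => (H t)%:R : R).
  rewrite (_ : (fun t => _) = (fun t => (G t)%:R - c0%:R)%R); last first.
    by apply/funext => t; rewrite (GE t) addrAC subrr add0r.
  exact: measurable_realfun.measurable_funB.
have mfs c : measurable_fun [set: R] (fun t => f (t - c)).
  exact: measurable_translate.
have mKf (K : R -> R) c : measurable_fun [set: R] K ->
    measurable_fun [set: R] (fun t => (K t * f (t - c))%:E).
  move=> mK; apply/measurable_EFinP; apply: measurable_realfun.measurable_funM.
    exact: mK.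
  exact: mfs.
have intf c : \int[mu]_t (c0%:R * f (t - c))%:E = c0%:R%:E.
  under eq_integral do rewrite EFinM.
  rewrite ge0_integralZl_EFin//; last 2 first.
  - by move=> t _; rewrite lee_fin.
  - by apply/measurable_EFinP; exact: mfs.
  rewrite (_ : \int[mu]_t _ = 1) ?mule1// -f1.
  rewrite -(@ge0_integral_translate _ (EFin \o f) (- c) setT)//; last 2 first.
  - exact/measurable_EFinP.
  - by move=> t _; rewrite lee_fin.
have split c : \int[mu]_t ((G t)%:R * f (t - c))%:E =
    c0%:R%:E + \int[mu]_t ((H t)%:R * f (t - c))%:E.
  rewrite -(intf c) -ge0_integralD//; last 4 first.
  - by move=> t _; rewrite lee_fin mulr_ge0.
  - exact: mKf.
  - by move=> t _; rewrite lee_fin mulr_ge0.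
  - exact: mKf.
  by apply: eq_integral => t _; rewrite -EFinD -mulrDl -GE.
rewrite !shiftE !split -addeA leeD2l//.
have -> : `|s - s'|%R = `|- s - - s'|%R by rewrite -opprD normrN.
have mD : measurable_fun [set: R] (fun t : R => `|f (t - s) - f (t - s')|%:E).
  apply/measurable_EFinP/measurableT_comp => //.
  by apply: measurable_realfun.measurable_funB; exact: mfs.
apply: (@le_trans _ _ (\int[mu]_t (((H t)%:R * f (t - s'))%:E +
    r%:R%:E * `|f (t - s) - f (t - s')|%:E))).
  apply: ge0_le_integral => //.
  - by move=> t _; rewrite lee_fin mulr_ge0.
  - exact: mKf.
  - apply: emeasurable_funD; last by apply: measurable_funeM; exact: mD.
    exact: mKf.
  move=> t _; rewrite -EFinM -EFinD lee_fin -lerBlDl -mulrBr.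
  rewrite (le_trans (ler_wpM2l _ (ler_norm _)))//.
  exact: ler_wpM2r.
rewrite ge0_integralD//; last 3 first.
- by move=> t _; rewrite lee_fin mulr_ge0.
- exact: mKf.
- by apply: measurable_funeM; exact: mD.
rewrite leeD2l// ge0_integralZl_EFin// EFinM lee_wpmul2l ?lee_fin//.
exact: integral_increment_le.
Qed.

End Density.

(** * Measurability of semicontinuous functions of random variables *)

Section UpperSemicontinuousMeasurability.
Variables (R : realType) (m : nat).
Implicit Types (h : ('I_m -> R) -> nat) (y : 'I_m -> R).

Definition usc_nat h := forall y, exists2 r : R, 0 < r &
  forall y', (forall j, `|y' j - y j| < r) -> (h y' <= h y)%N.

(** A sublevel set is open by semicontinuity, so it is the union of the cubes
with rational center and side that it contains; only countably many occur. *)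
Lemma usc_nat_measurable_lt h d (T : measurableType d) (Y : 'I_m -> T -> R)
    (k : nat) : usc_nat h -> (forall j, measurable_fun [set: T] (Y j)) ->
  measurable [set w | (h (Y^~ w) < k)%N].
Proof.
move=> husc mY.
pose good (qr : {ffun 'I_m -> rat} * rat) := forall y,
  (forall j, `|y j - ratr (qr.1 j)| < ratr qr.2) -> (h y < k)%N.
pose cube (qr : {ffun 'I_m -> rat} * rat) : set T :=
  \bigcap_(j in [set: 'I_m]) (Y j @^-1` ball (ratr (qr.1 j) : R) (ratr qr.2)).
rewrite (_ : [set w | _] = \bigcup_qr (if `[< good qr >] then cube qr else set0)).
  apply: countable_bigcupT_measurable => [|qr]; first exact: countableP.
  case: ifP => // _; apply: fin_bigcap_measurable => // j _.
  by rewrite -[_ @^-1` _]setTI; apply: mY => //; exact: measurable_ball.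
apply/seteqP; split=> [w /= hw|w [qr _]].
  have [r r0 hr] := husc (Y^~ w).
  (* Points within [e] of the same center are less than [2 * e < r] apart. *)
  have [e er] : exists e : rat, (ratr e : R) \in `]0, (r / 2)[.
    by apply: rat_in_itvoo; rewrite divr_gt0.
  move: er; rewrite in_itv/= => /andP[e0 er].
  have [q hq] : exists q : {ffun 'I_m -> rat}, forall j,
      `|Y j w - ratr (q j)| < ratr e.
    have /fin_all_exists[q hq] : forall j, exists q : rat,
        `|Y j w - ratr q| < ratr e.
      move=> j; have [q] : exists q : rat,
          (ratr q : R) \in `](Y j w - ratr e), (Y j w + ratr e)[.
        by apply: rat_in_itvoo; lra.
      rewrite in_itv/= => /andP[q1 q2]; exists q.
      by rewrite ltr_norml; apply/andP; split; lra.
    by exists (finfun q) => j; rewrite ffunE.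
  exists (q, e) => //; rewrite ifT.
    by move=> j _; rewrite /ball/= distrC; exact: hq.
  apply/asboolP => y /= yq; apply: leq_ltn_trans hw; apply: hr => j.
  have := yq j; have := hq j; rewrite !ltr_norml => /andP[? ?] /andP[? ?].
  by apply/andP; split; lra.
case: ifP => // /asboolP gqr cw; apply: gqr => j.
by rewrite distrC; exact: (cw j I).
Qed.

Lemma usc_nat_measurable h d (T : measurableType d) (Y : 'I_m -> T -> R) :
  usc_nat h -> (forall j, measurable_fun [set: T] (Y j)) ->
  measurable_fun [set: T] (fun w => (h (Y^~ w))%:R : R).
Proof.
move=> husc mY.
have mnat : measurable_fun [set: nat] (fun n : nat => n%:R : R) by [].
apply: (measurableT_comp mnat).
apply: (measurability _ (@NGenCInfty.measurableE)) => _ [_ [k ->] <-].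
rewrite setTI (_ : _ @^-1` _ = ~` [set w | (h (Y^~ w) < k)%N]).
  by apply: measurableC; exact: usc_nat_measurable_lt.
apply/seteqP; split=> w /=; rewrite in_itv/= andbT leEnat.
  by move=> kh; apply/negP; rewrite -leqNgt.
by move=> /negP; rewrite -leqNgt.
Qed.

End UpperSemicontinuousMeasurability.

(** * Independence *)

Section Independence.
Variables (dT : measure_display) (T : measurableType dT) (R : realType).
Variables (P : probability T R) (m : nat) (X : 'I_m -> {RV P >-> R}).
Local Open Scope ereal_scope.

Hypothesis indep : forall A : 'I_m -> set R, (forall i, measurable (A i)) ->
  P (\bigcap_(i in [set: 'I_m]) (X i @^-1` A i)) = \prod_i P (X i @^-1` A i).

Variable k : 'I_m.

(** A pi-system on the sample space; with the sigma-algebra that it generates,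
the sample space itself carries the law of the coordinates other than [k]. *)
Definition other_cylinders : set (set T) :=
  [set B | exists2 A : 'I_m -> set R, (forall i, measurable (A i)) &
    B = \bigcap_(i in [set i | i != k]) (X i @^-1` A i)].

Let T' := g_sigma_algebraType other_cylinders.

Let mX (i : 'I_m) (A : set R) : measurable A -> measurable (X i @^-1` A).
Proof. by move=> mA; rewrite -[_ @^-1` _]setTI; exact: measurable_funPT. Qed.

Lemma other_cylinders_measurable B : other_cylinders B -> measurable B.
Proof.
move=> [A mA ->]; apply: fin_bigcap_measurable => [|i _]; last exact: mX.
exact: finite_finset.
Qed.

Lemma other_cylinders_setI : setI_closed other_cylinders.
Proof.
move=> _ _ [A mA ->] [B mB ->]; exists (fun i => A i `&` B i).
  by move=> i; exact: measurableI.
by rewrite -bigcapI.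
Qed.

Lemma other_cylinders_setT : other_cylinders setT.
Proof.
exists (fun=> setT) => //; apply/seteqP; split=> // x _ i _ //.
Qed.

Lemma measurable_other (B : set T') : measurable B -> dT.-measurable (B : set T).
Proof.
apply: smallest_sub; first exact: sigma_algebra_measurable.
by move=> C; exact: other_cylinders_measurable.
Qed.

Lemma measurable_other_coord (j : 'I_m) : j != k ->
  measurable_fun [set: T'] (X j : T' -> R).
Proof.
move=> jk _ A mA; rewrite setTI; apply: sub_sigma_algebra.
exists (fun i => if i == j then A else setT) => [i|]; first by case: ifP.
apply/seteqP; split=> [w Aw i _ /=|w /(_ j jk)/=]; last by rewrite eqxx.
by case: eqP => // ->.
Qed.

(** Both sides are products over all coordinates, the [k]-th factor being the
one of [A] or of the whole line. *)
Lemma indep_cylinder (A : set R) (B : set T) : measurable A ->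
  other_cylinders B -> P (B `&` X k @^-1` A) = P (X k @^-1` A) * P B.
Proof.
move=> mA [C mC ->].
pose D (S : set R) i := if i == k then S else C i.
have mD S : measurable S -> forall i, measurable (D S i).
  by move=> mS i; rewrite /D; case: ifP.
have DE S : measurable S ->
    P (\bigcap_(i in [set i | i != k]) (X i @^-1` C i) `&` X k @^-1` S) =
    P (X k @^-1` S) * \prod_(i | i != k) P (X i @^-1` C i).
  move=> mS; rewrite (_ : _ `&` _ = \bigcap_(i in [set: 'I_m]) (X i @^-1` D S i)).
    rewrite (indep (mD S mS)) (bigD1 k)//= /D eqxx; congr (_ * _).
    by apply: eq_bigr => i /negPf ->.
  apply/seteqP; split=> [w [Cw Sw] i _|w h].
    by rewrite /D/=; case: eqP => [->//|/eqP ik]; exact: Cw.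
  split=> [i /negPf ik|]; first by have := h i I; rewrite /D/= ik.
  by have := h k I; rewrite /D/= eqxx.
rewrite (DE _ mA); congr (_ * _).
have := DE _ measurableT.
by rewrite preimage_setT setIT probability_setT mul1e.
Qed.

(** Two finite measures that agree on a pi-system agree on the sigma-algebra
that it generates. *)
Lemma indep_other (A : set R) (B : set T') : measurable A -> measurable B ->
  P (B `&` X k @^-1` A) = P (X k @^-1` A) * P B.
Proof.
move=> mA mB.
have PA0 : (0 <= fine (P (X k @^-1` A)))%R by exact: fine_ge0.
pose m1 := mrestr P (mX k mA).
pose m2 := mscale (NngNum PA0) P.
have PAE : P (X k @^-1` A) = (fine (P (X k @^-1` A)))%:E.
  by rewrite fineK// fin_num_measure//; exact: mX.
rewrite [in RHS]PAE.
apply: (@g_sigma_algebra_measure_unique _ _ _ other_cylinders _ (fun=> setT) _ _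
  m1 m2).
- by move=> ?; exact: other_cylinders_measurable.
- by move=> _; exact: other_cylinders_setT.
- by rewrite bigcup_const.
- exact: other_cylinders_setI.
- move=> C hC.
  change (P (C `&` X k @^-1` A) = (fine (P (X k @^-1` A)))%:E * P C).
  by rewrite -PAE; exact: indep_cylinder.
- move=> _; change (P (setT `&` X k @^-1` A) < +oo).
  by rewrite setTI PAE; exact: ltry.
- exact: mB.
Qed.

Let idT' (w : T) : T' := w.

Let midT' : measurable_fun [set: T] idT'.
Proof. by move=> _ B mB; rewrite setTI; exact: measurable_other. Qed.

Definition law_other : probability T' R :=
  distribution P
    (HB.pack idT' (isMeasurableFun.Build _ _ _ _ idT' midT') : {mfun T >-> T'}).

(** Independence in the form of Fubini: the coordinate [k] may be integrated
first, the other coordinates being frozen. *)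
Lemma integral_split_coord (F : R * T' -> \bar R) :
  measurable_fun [set: R * T'] F -> (forall z, 0 <= F z) ->
  \int[P]_w F (X k w, w) =
  \int[law_other]_w \int[distribution P (X k)]_t F (t, w).
Proof.
move=> mF F0.
pose phi (w : T) : R * T' := (X k w, idT' w).
have mphi : measurable_fun [set: T] phi by exact: measurable_fun_pair.
pose Phi : {mfun T >-> (R * T')%type} :=
  HB.pack phi (isMeasurableFun.Build _ _ _ _ phi mphi).
rewrite -fubini_tonelli2//.
transitivity (\int[distribution P Phi]_z F z).
  by rewrite ge0_integral_distribution.
apply: eq_measure_integral => S mS _; apply/esym.
apply: (@product_measure_unique _ _ _ _ _ (distribution P (X k)) law_other) => //.
move=> A B mA mB.
rewrite /law_other /distribution /pushforward/= -(indep_other mA mB).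
by congr (P _); apply/seteqP; split=> [w []|w []].
Qed.

End Independence.

(** * The Wegner estimate for a diagonal family *)

Section CouplingShift.
Variables (dT : measure_display) (T : measurableType dT) (R : realType).
Variables (P : probability T R) (m : nat) (X : 'I_m -> {RV P >-> R}).
Variables (f : R -> R) (V : R).
Local Open Scope ereal_scope.

Hypothesis indep : forall A : 'I_m -> set R, (forall i, measurable (A i)) ->
  P (\bigcap_(i in [set: 'I_m]) (X i @^-1` A i)) = \prod_i P (X i @^-1` A i).
Hypotheses (f_density : prob_density f) (Xf : forall i, has_density (X i) f).
Hypothesis fV : forall a b, (a <= b)%R -> total_variation a b f <= V%:E.

Variables (h : ('I_m -> R) -> nat) (N r : nat).
Hypotheses (h_usc : usc_nat h) (hN : forall y, (h y <= N)%N).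
Hypothesis h_coord : forall k y y', (forall j, j != k -> y' j = y j) ->
  (h y' <= h y + r)%N.

Definition shifted_mean (a : 'I_m -> R) : \bar R :=
  \int[P]_w (h (fun j => X j w + a j)%R)%:R%:E.

(** Freeze the other coordinates; what remains is a function of one variable
with oscillation at most [r], integrated against shifts of its density. *)
Lemma shifted_mean_coord (k : 'I_m) (a a' : 'I_m -> R) :
  (forall j, j != k -> a' j = a j) ->
  shifted_mean a <= shifted_mean a' + (r%:R * (`|a k - a' k| * V))%:E.
Proof.
move=> aa'; have [f0 mf f1] := f_density.
pose T' := g_sigma_algebraType (other_cylinders X k).
pose y (t : R) (w : T') j : R := if j == k then t else (X j w + a j)%R.
pose G (w : T') t := h (y t w).
pose F c (z : R * T') : \bar R := (G z.2 (z.1 + c)%R)%:R%:E.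
have mF c : measurable_fun setT (F c).
  apply/measurable_EFinP.
  have my j : measurable_fun setT (fun z : R * T' => y (z.1 + c)%R z.2 j).
    rewrite /y; case: (boolP (j == k)) => jk.
      by apply: measurable_realfun.measurable_funD => //; exact: measurable_fst.
    apply: measurable_realfun.measurable_funD => //.
    have := measurableT_comp (measurable_other_coord (X := X) jk)
      (@measurable_snd _ _ R T').
    exact.
  exact: (usc_nat_measurable h_usc my).
have F0 c z : 0 <= F c z by rewrite lee_fin.
have meanE b : (forall j, j != k -> b j = a j) ->
    shifted_mean b = \int[P]_w F (b k) (X k w, w).
  move=> ba; apply: eq_integral => w _; rewrite /F /G/=.
  congr ((h _)%:R%:E); apply/funext => j; rewrite /y.
  by case: eqP => [->//|/eqP /ba ->].
have mG w t0 n : measurable [set t | (n < G w (t + t0)%R)%N].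
  rewrite (_ : [set t | _] = ~` [set t | (G w (t + t0)%R < n.+1)%N]).
    apply/measurableC.
    have my j : measurable_fun setT (fun t : R => y (t + t0)%R w j).
      by rewrite /y; case: (j == k) => //; exact: measurable_addr.
    exact: (usc_nat_measurable_lt n.+1 h_usc my).
  by apply/seteqP; split=> t /=; rewrite [(n < _)%N]ltnNge ltnS => /negP.
have inner w c : \int[distribution P (X k)]_t F c (t, w) =
    \int[lebesgue_measure]_t ((G w (t + c)%R)%:R * f t)%:E.
  apply: (ge0_integral_density (G := fun t => G w (t + c)%R) f0 mf (N := N)).
  - exact: Xf.
  - exact: mG.
  - by move=> t; exact: hN.
rewrite (meanE a)// (meanE a')//.
rewrite !(integral_split_coord indep) //.
apply: (@le_trans _ _ (\int[law_other X k]_w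
    (\int[distribution P (X k)]_t F (a' k) (t, w) +
     cst (r%:R * (`|a k - a' k| * V))%:E w))).
  apply: ge0_le_integral => //.
  - by move=> w _; exact: integral_ge0.
  - exact: measurable_fun_fubini_tonelli_G.
  - apply: emeasurable_funD => //.
    exact: measurable_fun_fubini_tonelli_G.
  move=> w _; rewrite !inner.
  apply: (integral_density_shift f0 mf f1 fV) => [|t t'].
    have my j : measurable_fun setT (fun t : R => y t w j).
      by rewrite /y; case: (j == k).
    exact: (usc_nat_measurable h_usc my).
  by apply: (h_coord (k := k)) => j /negPf jk; rewrite /y jk.
have V0 : (0 <= V)%R.
  by rewrite -lee_fin (le_trans _ (fV (lexx 0%R)))// total_variation_ge0.
rewrite ge0_integralD//; last 3 first.
- by move=> w _; exact: integral_ge0.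
- exact: measurable_fun_fubini_tonelli_G.
- by move=> w _; rewrite lee_fin mulr_ge0// mulr_ge0.
rewrite integral_cst// [X in _ + _ * X](_ : _ = 1) ?mule1//.
exact: (probability_setT (law_other X k)).
Qed.

(** Telescoping: replace the components of [a] by those of [b] one by one. *)
Lemma shifted_mean_le (a b : 'I_m -> R) :
  shifted_mean a <=
  shifted_mean b + (r%:R * ((\sum_j `|a j - b j|) * V))%:E.
Proof.
pose v n (j : 'I_m) := if (j < n)%N then b j else a j.
have step n : (n <= m)%N -> shifted_mean a <= shifted_mean (v n) +
    (r%:R * ((\sum_(j < m | (j < n)%N) `|a j - b j|) * V))%:E.
  elim: n => [_|n IH nm].
    by rewrite big_pred0// mul0r mulr0 adde0 (_ : v 0%N = a).
  pose k := Ordinal nm.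
  apply: le_trans (IH (ltnW nm)) _.
  have vv j : j != k -> v n.+1 j = v n j.
    move=> jk; rewrite /v ltnS leq_eqVlt.
    by rewrite (_ : (j == n :> nat) = false)//; apply/negbTE.
  have := shifted_mean_coord vv.
  rewrite {3 4}/v/= ltnn ltnSn => /leeD2r.
  move=> /(_ (r%:R * ((\sum_(j < m | (j < n)%N) `|a j - b j|) * V))%:E).
  move=> /le_trans; apply; rewrite -addeA -EFinD -mulrDr -mulrDl.
  rewrite [in leRHS](bigD1 k)//=.
  rewrite [in leRHS](eq_bigl (fun j : 'I_m => (j < n)%N)) ?lexx// => j.
  rewrite ltnS; case: (eqVneq j k) => [->/=|jk]; first by rewrite ltnn andbF.
  by rewrite andbT leq_eqVlt (_ : (j == n :> nat) = false)//; apply/negbTE.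
have := step m (leqnn m).
rewrite (_ : v m = b); last by apply/funext => j; rewrite /v ltn_ord.
by rewrite (eq_bigl xpredT)// => j; rewrite ltn_ord.
Qed.

Lemma shifted_mean_fin_num (a : 'I_m -> R) : shifted_mean a \is a fin_num.
Proof.
rewrite ge0_fin_numE; last by apply: integral_ge0 => w _; rewrite lee_fin.
apply: (@le_lt_trans _ _ (\int[P]_w cst N%:R%:E w)).
  apply: ge0_le_integral => //.
  - apply/measurable_EFinP.
    have mXa j : measurable_fun setT (fun w => X j w + a j)%R.
      exact: measurable_realfun.measurable_funD.
    exact: (usc_nat_measurable h_usc mXa).
  - by move=> w _; rewrite lee_fin ler_nat.
rewrite integral_cst// [X in _ * X](_ : _ = 1) ?mule1 ?ltry//.
exact: (probability_setT P).
Qed.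

End CouplingShift.

(** Monotonicity without measurability: the integral of a nonnegative function
is a supremum over the simple functions below it.  So the trace of the spectral
projection can be bounded without being shown measurable in the parameters. *)
Lemma ge0_le_integralT d (T : measurableType d) (R : realType)
    (mu : {measure set T -> \bar R}) (f1 f2 : T -> \bar R) :
  (forall x, 0 <= f1 x)%E -> (forall x, f1 x <= f2 x)%E ->
  (\int[mu]_x f1 x <= \int[mu]_x f2 x)%E.
Proof.
move=> f10 f12; rewrite !ge0_integralTE//; last first.
  by move=> x; exact: le_trans (f12 x).
apply: le_ereal_sup => _ [g /= gf <-]; exists g => //= x.
exact: le_trans (f12 x).
Qed.

Section DiagonalWegner.
Variables (dT : measure_display) (T : measurableType dT) (R : realType).
Variables (P : probability T R) (m N r : nat) (X : 'I_m -> {RV P >-> R}).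
Variables (f : R -> R) (V : R).
Local Open Scope ereal_scope.

Hypothesis indep : forall A : 'I_m -> set R, (forall i, measurable (A i)) ->
  P (\bigcap_(i in [set: 'I_m]) (X i @^-1` A i)) = \prod_i P (X i @^-1` A i).
Hypotheses (f_density : prob_density f) (Xf : forall i, has_density (X i) f).
Hypothesis fV : forall a b, (a <= b)%R -> total_variation a b f <= V%:E.

Variables (A : 'M[R[i]]_N) (C : 'I_m -> 'I_N -> R) (a : 'I_m -> R).
Hypothesis hA : A \is hermsymmx.
Hypothesis Cr : forall j, (#|[pred i | (C j i != 0)%R]| <= r)%N.
Hypothesis a1 : forall i, (\sum_j a j * C j i = 1)%R.

(** The window is enlarged on the left to a half-open one, so that its trace is
a difference of two counting functions; the shift of the left end by [2 * eps]
instead of [eps] accounts for the factor 3. *)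
Lemma wegner_diag_family (E eps : R) : (0 < eps)%R ->
  \int[P]_w (trace_indic `[(E - eps)%R, (E + eps)%R]%classic
    (diag_family A C (fun j => X j w)))%:E <=
  (r%:R * (3 * eps * (\sum_j `|a j|) * V))%:E.
Proof.
move=> eps0; pose h y := eig_count (diag_family A C y) E.
have h_usc : usc_nat h by move=> y; exact: eig_count_diag_family_usc.
have hN y : (h y <= N)%N by rewrite -[leqRHS]card_ord; exact: max_card.
have h_coord k y y' : (forall j, j != k -> y' j = y j) -> (h y' <= h y + r)%N.
  move=> yy'; apply: leq_trans (eig_count_diag_family_coord C hA E yy') _.
  by rewrite leq_add2l.
pose y1 w j := (X j w + (- eps) * a j)%R.
pose y2 w j := (X j w + (2 * eps) * a j)%R.
have tr_le w : (trace_indic `[(E - eps)%R, (E + eps)%R]%classic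
    (diag_family A C (fun j => X j w)) <= (h (y1 w))%:R - (h (y2 w))%:R)%R.
  rewrite /h /y1 /y2 !eig_count_diag_family_shift// opprK lerBrDr.
  by apply: trace_indic_le_count; lra.
have mh b : measurable_fun [set: T] (fun w => (h (fun j => X j w + b j)%R)%:R : R).
  have mXb j : measurable_fun setT (fun w => X j w + b j)%R.
    exact: measurable_realfun.measurable_funD.
  exact: (usc_nat_measurable h_usc mXb).
have mean_le := shifted_mean_le indep f_density Xf fV h_usc hN h_coord
  (fun j => (- eps) * a j)%R (fun j => (2 * eps) * a j)%R.
have mean_fin := shifted_mean_fin_num X h_usc hN (fun j => (2 * eps) * a j)%R.
have sumE : (\sum_j `|(- eps) * a j - (2 * eps) * a j| = 3 * eps * \sum_j `|a j|)%R.
  rewrite mulr_sumr; apply: eq_bigr => j _; rewrite -mulrBl normrM.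
  by congr (_ * _)%R; rewrite ler0_norm; lra.
rewrite sumE in mean_le.
apply: (@le_trans _ _ (\int[P]_w ((h (y1 w))%:R - (h (y2 w))%:R)%:E)).
  apply: ge0_le_integralT => w; first by rewrite lee_fin trace_indic_ge0.
  by rewrite lee_fin tr_le.
rewrite -(leeD2lE _ _ mean_fin); apply: le_trans mean_le.
rewrite /shifted_mean -ge0_integralD//; last 3 first.
- exact/measurable_EFinP/mh.
- move=> w _; rewrite lee_fin; exact: le_trans (trace_indic_ge0 _ _) (tr_le w).
- apply/measurable_EFinP; apply: measurable_realfun.measurable_funB; exact: mh.
by apply: ge0_le_integralT => w; rewrite lee_fin// addrC subrK.
Qed.

End DiagonalWegner.

(** * Moments and translation-invariant combinations *)

Section Moments.
Variables (R : realType) (I : finType) (d n : nat).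
Variables (x : I -> 'I_d -> 'I_n.+1) (w : I -> R).
Implicit Type J : {ffun 'I_d -> 'I_n.+1}.

Definition moment J : R := \sum_i w i * \prod_j (x i j)%:R ^+ J j.

Lemma sum_prod_horner (q : 'I_d -> {poly R}) :
  (forall j, (size (q j) <= n.+1)%N) ->
  \sum_i w i * \prod_j (q j).[(x i j)%:R] =
  \sum_(J : {ffun 'I_d -> 'I_n.+1}) (\prod_j (q j)`_(J j)) * moment J.
Proof.
move=> qn; under [RHS]eq_bigr do rewrite mulr_sumr.
rewrite exchange_big/=; apply: eq_bigr => i _.
under eq_bigr do rewrite (horner_coef_wide _ (qn _)).
rewrite bigA_distr_bigA/= mulr_sumr; apply: eq_bigr => J _.
by rewrite big_split/= mulrCA.
Qed.

(** If all moments vanished, so would the pairing of [w] with every product of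
polynomials of degree at most [n] in each variable, in particular with the
Lagrange polynomial that singles out the point [x i0]. *)
Lemma exists_moment_neq0 : (forall i i', x i =1 x i' -> i = i') ->
  (exists i, w i != 0) -> exists J, moment J != 0.
Proof.
move=> xinj [i0 wi0]; apply/existsP; apply: contra_neqT wi0.
move=> /existsPn/= m0.
pose s j := [seq t <- enum 'I_n.+1 | t != x i0 j].
pose q j : {poly R} := \prod_(t <- s j) ('X - (t : nat)%:R%:P).
have qn j : (size (q j) <= n.+1)%N.
  rewrite /q size_prod_XsubC ltnS -ltnS -[X in (_ < X)%N](size_enum_ord n.+1).
  rewrite size_filter -(count_predC (fun t => t != x i0 j)).
  rewrite -[ltnLHS]addn0 ltn_add2l -has_count; apply/hasP; exists (x i0 j).
    by rewrite mem_enum.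
  by rewrite /= eqxx.
have := sum_prod_horner qn.
rewrite [RHS]big1; last first.
  by move=> J _; have := m0 J; rewrite negbK => /eqP ->; rewrite mulr0.
rewrite (bigD1 i0)//= [X in _ + X]big1 ?addr0; last first.
  move=> i ii0; have [j xj] : exists j, x i j != x i0 j.
    apply/existsP; rewrite -negb_forall; apply: contra_neqN ii0 => /forallP h.
    by apply: xinj => j; apply/eqP.
  rewrite (bigD1 j)//= /q horner_prod (big_rem (x i j))/=.
    by rewrite hornerXsubC subrr !mul0r mulr0.
  by rewrite mem_filter xj mem_enum.
move=> /eqP; rewrite mulf_eq0 => /orP[/eqP //|].
rewrite prodf_seq_eq0 => /hasP[j _ /=].
rewrite /q horner_prod prodf_seq_eq0 => /hasP[t]; rewrite mem_filter => /andP[tx _].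
rewrite hornerXsubC subr_eq0 eqr_nat => /eqP/val_inj xt.
by rewrite xt eqxx in tx.
Qed.

(** A nonzero moment of least total degree. *)
Lemma exists_minimal_moment : (forall i i', x i =1 x i' -> i = i') ->
  (exists i, w i != 0) -> exists2 J, moment J != 0 &
  forall J', (forall j, (J' j <= J j)%N) -> J' != J -> moment J' = 0.
Proof.
move=> xinj w0; have [J0 mJ0] := exists_moment_neq0 xinj w0.
case: (@arg_minnP _ J0 (fun J => moment J != 0)
  (fun J => \sum_j (J j : nat))%N mJ0) => J mJ Jmin.
exists J => // J' J'J; apply: contra_neq_eq => mJ'.
have := Jmin J' mJ' => sJ; apply/ffunP => j; apply/val_inj/eqP.
rewrite eqn_leq J'J/= leqNgt; apply/negP => lt.
move: sJ; rewrite leqNgt => /negP; apply.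
rewrite (bigD1 j)//= [X in (_ < X)%N](bigD1 j)//= -addSn leq_add//.
by apply: leq_sum.
Qed.

(** Expanding the translated monomial gives the moments of order at most [J];
all but the top one vanish, and the top coefficient is 1. *)
Lemma sum_translated_monomial J (z : 'I_d -> R) :
  (forall J', (forall j, (J' j <= J j)%N) -> J' != J -> moment J' = 0) ->
  \sum_i w i * \prod_j (z j + (x i j)%:R) ^+ J j = moment J.
Proof.
(* A power of the monic linear polynomial with value [z j + t] at [t]. *)
move=> Jmin; pose q j : {poly R} := ('X - (- z j)%:P) ^+ J j.
have sq j : size (q j) = (J j).+1 by exact: size_exp_XsubC.
have qn j : (size (q j) <= n.+1)%N by rewrite sq.
have qE i : \prod_j (z j + (x i j)%:R) ^+ J j = \prod_j (q j).[(x i j)%:R].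
  by apply: eq_bigr => j _; rewrite horner_exp hornerXsubC opprK addrC.
under eq_bigr do rewrite qE.
rewrite (sum_prod_horner qn) (bigD1 J)//= [X in _ + X]big1 ?addr0.
  rewrite big1 ?mul1r// => j _.
  have /monicP := monic_exp (J j) (monicXsubC (- z j)).
  by rewrite /lead_coef sq.
move=> J' J'J; have [/forallP le|] := boolP [forall j, (J' j <= J j)%N].
  by rewrite Jmin ?mulr0.
rewrite negb_forall => /existsP[j]; rewrite -ltnNge => lt.
by rewrite (bigD1 j)//= nth_default ?mul0r// sq.
Qed.

End Moments.

(** * Functions on the lattice and their restriction to boxes *)

Section SupportedSums.
Variables (R : realType) (I : choiceType).

Lemma rsum_supported_at (g : I -> R) (a : I) :
  (forall x, x != a -> g x = 0) -> rsum g = g a.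
Proof.
move=> ga.
have esumE (h : I -> R) : (forall x, 0 <= h x) -> (forall x, x != a -> h x = 0) ->
    (\esum_(x in [set: I]) (h x)%:E)%E = (h a)%:E.
  move=> h0 ha; rewrite -(@esum_set1 _ _ a (fun x => (h x)%:E)) ?lee_fin//.
  rewrite [RHS]esum_mkcond; apply: eq_esum => x _.
  by case: (eqVneq x a) => [->|xa];
    [rewrite mem_set|rewrite memNset ?ha//; exact/eqP].
rewrite /rsum !esumE => [|x|x xa|x|x xa].
- by rewrite /= -[in RHS](funrposBneg g).
- exact: funrneg_ge0.
- by rewrite /funrneg ga// oppr0 maxxx.
- exact: funrpos_ge0.
- by rewrite /funrpos ga// maxxx.
Qed.

Lemma csum_supported_at (psi : I -> R[i]) (a : I) :
  (forall x, x != a -> psi x = 0) -> csum psi = psi a.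
Proof.
move=> psia; rewrite /csum !(@rsum_supported_at _ a); first by case: (psi a).
  by move=> x /psia ->.
by move=> x /psia ->.
Qed.

End SupportedSums.

Section BoxLemmas.
Variables (R : realType) (d : nat).

Lemma fsum_box (M : nat) (g : Zd d -> R) :
  (forall k, g k != 0 -> @box d M k) ->
  \sum_(k \in [set: Zd d]) g k = \sum_(j < box_card d M) g (box_pt j).
Proof.
move=> gM; pose s := map (@box_pt d M) (enum 'I_(box_card d M)).
have us : uniq s by rewrite map_inj_uniq ?enum_uniq//; exact: box_pt_inj.
transitivity (\sum_(k <- s) g k); last by rewrite big_map big_enum.
rewrite [RHS]fsbig_seq//; apply/esym; apply: fsbig_widen => // k [_ /= ks].
apply/eqP; apply: contra_notT ks => /gM; rewrite -box_pt_range => -[j _ <-].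
by apply: map_f; rewrite mem_enum.
Qed.

(** The matrix entries are inner products against canonical basis vectors,
which lie in the domain of the operator. *)
Lemma compression_hermitian (L : nat) (D : set (Zd d -> R[i]))
    (H0 : (Zd d -> R[i]) -> (Zd d -> R[i])) : symmetric_operator D H0 ->
  \matrix_(i, j) box_restr L (H0 (box_incl (delta_mx j 0))) i 0 \is hermsymmx.
Proof.
move=> H0s.
pose e (j : 'I_(box_card d L)) : Zd d -> R[i] := box_incl (delta_mx j 0).
have eE j x : e j x = (x == box_pt j)%:R.
  rewrite /e /box_incl (bigD1 j)//= big1 ?addr0.
    by rewrite mxE !eqxx; case: (x == _).
  by move=> i ij; rewrite mxE (negPf ij)/=; case: ifP.
have eD j : D (e j).
  apply: (symop_dom_finite H0s).
  apply: (sub_finite_set _ (finite_set1 (box_pt j))).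
  move=> x /=; rewrite eE.
  by case: (eqVneq x (box_pt j)) => [->|_] //; move=> /eqP.
have conjE j i : Num.conj (H0 (e j) (box_pt i)) = H0 (e i) (box_pt j).
  have := symop_symmetric H0s (eD j) (eD i).
  rewrite /ell2_inner (@csum_supported_at _ _ _ (box_pt i)); last first.
    by move=> x xi; rewrite eE (negPf xi) mulr0.
  rewrite (@csum_supported_at _ _ _ (box_pt j)); last first.
    by move=> x xj; rewrite eE (negPf xj) mulr0n raddf0 mul0r.
  by rewrite !eE !eqxx mulr1n mulr1 rmorph1 mul1r.
apply/is_hermitianmxP; rewrite expr0 scale1r; apply/matrixP => i j.
rewrite !mxE -/(e i) -/(e j); exact/esym/conjE.
Qed.

End BoxLemmas.

(** * Weights that turn the alloy potential into a constant *)

Section AlloyWeights.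
Variables (R : realType) (d n : nat) (u : Zd d -> R).
Hypothesis u_n : [set x | u x != 0] `<=` @boxN d n.

Lemma boxN_opp (x : Zd d) : @boxN d n x -> @box d n (- x).
Proof. by move=> xn j; have /andP[h h'] := xn j; rewrite mxE oppr_ge0 h' lerNl. Qed.

Lemma site_box (L M : nat) (x k : Zd d) : (n <= M)%N ->
  @box d L x -> u (x - k) != 0 -> @box d (L + M) k.
Proof.
move=> nM xL /u_n xk j; have /andP[x0 xl] := xL j; have := xk j.
rewrite !mxE subr_le0 => /andP[kn xk']; rewrite (le_trans x0 xk')/=.
have nM' : n%:Z <= M%:Z by rewrite lez_nat.
by rewrite PoszD; lra.
Qed.

Lemma alloy_potential_box (L M : nat) (omega : Zd d -> R) (i : 'I_(box_card d L)) :
  (n <= M)%N -> alloy_potential u omega (box_pt i) =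
  \sum_(j < box_card d (L + M)) omega (box_pt j) * u (box_pt i - box_pt j).
Proof.
move=> nM; apply: (@fsum_box _ _ _ (fun k => omega k * u (box_pt i - k))) => k.
rewrite mulf_eq0 negb_or => /andP[_]; apply: site_box => //.
by rewrite -box_pt_range; exists i.
Qed.

(** The site [k] acts on a box point exactly when their difference lies in the
support of [u]. *)
Lemma card_site_potential (L : nat) (k : Zd d) :
  (#|[pred i : 'I_(box_card d L) | (u (box_pt i - k) != 0)%R]| <= pot_rank u)%N.
Proof.
have ufin : finite_set [set x | u x != 0].
  apply: (@sub_finite_set _ _ (-%R @` range (@box_pt d n))).
    move=> x /u_n /boxN_opp; rewrite -box_pt_range => xb.
    by exists (- x) => //; rewrite opprK.
  by apply: finite_image; apply: finite_image; exact: finite_finset.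
rewrite /pot_rank cardE -(size_map (fun i => box_pt i - k)).
apply: uniq_leq_size.
  by rewrite map_inj_uniq ?enum_uniq// => i j /addIr/box_pt_inj.
move=> _ /mapP[i + ->]; rewrite mem_enum inE => ui.
by rewrite in_fset_set// inE.
Qed.

Variables (J : {ffun 'I_d -> 'I_n.+1}).
Let y (i : 'I_(box_card d n)) (l : 'I_d) : 'I_n.+1 := enum_val i 0 l.
Let w (i : 'I_(box_card d n)) : R := u (- box_pt i).

Definition alloy_moment := moment y w J.

Definition alloy_weight (k : Zd d) : R :=
  (\prod_l (k 0 l)%:~R ^+ J l) / alloy_moment.

(** With [k = x + p] the sum becomes the translated monomial paired with
[p |-> u (- p)], a constant by the minimality of [J]. *)
Lemma sum_alloy_weight (L M : nat) (i : 'I_(box_card d L)) : (n <= M)%N ->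
  alloy_moment != 0 ->
  (forall J' : {ffun 'I_d -> 'I_n.+1}, (forall j, (J' j <= J j)%N) ->
    J' != J -> moment y w J' = 0) ->
  \sum_(j < box_card d (L + M))
    alloy_weight (box_pt j) * u (box_pt i - box_pt j) = 1.
Proof.
move=> nM m0 Jmin; set x := box_pt i.
have xL : @box d L x by rewrite -box_pt_range; exists i.
rewrite -(@fsum_box _ _ _ (fun k => alloy_weight k * u (x - k))); last first.
  by move=> k; rewrite mulf_eq0 negb_or => /andP[_]; exact: site_box.
rewrite (@reindex_fsbigT _ _ _ _ _ (fun p => x + p)); last first.
  by exists (fun p => p - x) => p; rewrite addrC ?addKr// subrK.
rewrite (@fsum_box _ _ n (fun p => alloy_weight (x + p) * u (x - (x + p))));
    last first.
  move=> p; rewrite mulf_eq0 negb_or opprD addNKr => /andP[_ /u_n/boxN_opp].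
  by rewrite opprK.
rewrite -[RHS](divff m0) {1}/alloy_moment.
rewrite -(sum_translated_monomial (fun l => (x 0 l)%:~R) Jmin).
rewrite mulr_suml; apply: eq_bigr => p _.
rewrite opprD addNKr mulrC -mulrA; congr (_ * (_ / _)).
by apply: eq_bigr => l _; rewrite !mxE intrD.
Qed.

(** There are [(L + M).+1 ^ d] sites, and each monomial is at most
[(L + M) ^ (d * M)].  The factor [2 ^ d] absorbs the successor. *)
Lemma sum_norm_alloy_weight (M L : nat) : (n <= M)%N -> (0 < M)%N ->
  alloy_moment != 0 ->
  \sum_(j < box_card d (L + M)) `|alloy_weight (box_pt j)| <=
  2 ^+ d / `|alloy_moment| * (L + M)%:R ^+ (d * M.+1).
Proof.
move=> nM M0 m0.
have K1 : 1 <= (L + M)%:R :> R by rewrite ler1n addn_gt0 M0 orbT.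
have le1 (j : 'I_(box_card d (L + M))) : `|alloy_weight (box_pt j)| <=
    (L + M)%:R ^+ (d * M) / `|alloy_moment|.
  rewrite /alloy_weight normrM normfV; apply: ler_wpM2r; first by rewrite invr_ge0.
  rewrite normr_prod mulnC exprM -[X in _ ^+ X]card_ord -prodr_const.
  apply: ler_prod => l _; rewrite normr_ge0/= normrX.
  apply: (@le_trans _ _ ((L + M)%:R ^+ J l)).
    rewrite lerXn2r ?nnegrE// mxE /= -pmulrn ger0_norm// ler_nat.
    by rewrite -ltnS ltn_ord.
  by apply: ler_weXn2l => //; apply: leq_trans nM; rewrite -ltnS ltn_ord.
apply: le_trans (ler_sum _ (fun j _ => le1 j)) _.
rewrite sumr_const card_ord /box_card card_mx card_ord mul1n.
rewrite -[_ *+ (_ ^ _)]mulr_natr natrX.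
have le2 : (L + M).+1%:R ^+ d <= 2 ^+ d * (L + M)%:R ^+ d :> R.
  by rewrite -exprMn lerXn2r ?nnegrE// -natr1 mulr_natl mulr2n lerD2l.
rewrite [leRHS](_ : _ = (L + M)%:R ^+ (d * M) / `|alloy_moment| *
    (2 ^+ d * (L + M)%:R ^+ d)); last by rewrite mulnS exprD; ring.
by apply: ler_wpM2l => //; rewrite divr_ge0// exprn_ge0.
Qed.

End AlloyWeights.

(** * The Wegner estimate for alloy-type models *)

Lemma mutually_independent_inj (dT : measure_display) (T : measurableType dT)
    (R : realType) (P : probability T R) (I : choiceType)
    (X : I -> {RV P >-> R}) (m : nat) (g : 'I_m -> I) : injective g ->
  mutually_independent X ->
  forall A : 'I_m -> set R, (forall i, measurable (A i)) ->
  (P (\bigcap_(i in [set: 'I_m]) (X (g i) @^-1` A i)) =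
   \prod_i P (X (g i) @^-1` A i))%E.
Proof.
move=> ginj indep A mA.
pose s := map g (enum 'I_m).
have us : uniq s by rewrite map_inj_uniq ?enum_uniq.
pose A' k : set R := if [pick j | g j == k] is Some j then A j else setT.
have A'g j : A' (g j) = A j.
  rewrite /A'; case: pickP => [i /eqP/ginj ->//|/(_ j)].
  by rewrite eqxx.
have mA' k : measurable (A' k) by rewrite /A'; case: pickP.
have := indep [fset k in s]%fset A' mA'.
rewrite (perm_big s); last first.
  by apply: uniq_perm => // k; rewrite inE.
rewrite big_map big_enum/=.
under eq_bigr do rewrite A'g.
move=> <-; congr (P _); apply/seteqP; split=> [w Aw k /=|w Aw i _].
  by rewrite inE => /mapP[i _ ->]; rewrite A'g; exact: Aw.
rewrite /= -A'g; apply: (Aw (g i)); rewrite /= inE; apply: map_f.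
by rewrite mem_enum.
Qed.

Theorem theorem1 (R : realType) (d : nat) (hd : (0 < d)%N) (u : Zd d -> R)
    (hu : exists x, u x != 0) :
  exists c : R, 0 < c /\
  forall n : nat, (0 < n)%N -> [set x | u x != 0] `<=` @boxN d n ->
  forall (D : set (Zd d -> R[i])) (H0 : (Zd d -> R[i]) -> (Zd d -> R[i])),
    symmetric_operator D H0 ->
  forall f : R -> R, prob_density f -> in_BV f ->
  forall (dT : measure_display) (T : measurableType dT) (P : probability T R)
    (omega : Zd d -> {RV P >-> R}),
    mutually_independent omega -> (forall k, has_density (omega k) f) ->
  forall (L : nat) (E eps : R), (0 < L)%N -> 0 < eps ->
  ('E_P[fun w => trace_indic `[(E - eps)%R, (E + eps)%R]%classic
          (box_hamiltonian L H0 (alloy_potential u (fun k => omega k w)))]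
   <= c%:E * ((pot_rank u)%:R%R)%:E * BVnorm f * eps%:E *
      ((L + n)%:R ^+ (d * n.+1)%N)%R%:E)%E.
Proof.
(* The constant must be chosen before [n]: use the moments attached to the
   smallest box that contains the support. *)
have [[n1 un1]|nobox] := pselect (exists n, [set x | u x != 0] `<=` @boxN d n);
  last first.
  by exists 1; split=> // n _ un; exfalso; apply: nobox; exists n.
have ex : exists n, `[< [set x | u x != 0] `<=` @boxN d n >].
  by exists n1; apply/asboolP.
have [n0 /asboolP un0 n0min] := ex_minnP ex.
pose y (i : 'I_(box_card d n0)) (l : 'I_d) : 'I_n0.+1 := enum_val i 0 l.
pose v (i : 'I_(box_card d n0)) : R := u (- box_pt i).
have yinj i i' : y i =1 y i' -> i = i'.
  by move=> yy; apply: enum_val_inj; apply/rowP => l; exact: yy.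
have v0 : exists i, v i != 0.
  have [x ux] := hu; have := boxN_opp (un0 x ux).
  rewrite -box_pt_range => -[i _ ix]; exists i.
  by rewrite /v ix opprK.
have [J mJ Jmin] := exists_minimal_moment yinj v0.
have mJ' : alloy_moment u J != 0 by [].
exists (3 * 2 ^+ d / `|alloy_moment u J|); split.
  by rewrite divr_gt0 ?mulr_gt0 ?exprn_gt0 ?normr_gt0.
move=> n n_gt0 un D H0 H0s f fd fBV dT T P omega om_indep om_f L E eps L0 eps0.
have n0n : (n0 <= n)%N by apply: n0min; apply/asboolP.
have BV0 : (0%:E <= BVnorm f)%E.
  apply: (@le_trans _ _ (total_variation 0 0 f)); first exact: total_variation_ge0.
  by apply: ereal_sup_ubound; exists (0, 0) => //=; exact: lexx.
pose V := fine (BVnorm f).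
have VE : BVnorm f = V%:E by rewrite /V fineK// ge0_fin_numE.
have fV a b : a <= b -> (total_variation a b f <= V%:E)%E.
  by move=> ab; rewrite -VE; apply: ereal_sup_ubound; exists (a, b).
pose C (j : 'I_(box_card d (L + n))) (i : 'I_(box_card d L)) :=
  u (box_pt i - box_pt j).
pose B : 'M[R[i]]_(box_card d L) := \matrix_(i, j)
  box_restr L (H0 (box_incl (delta_mx j 0))) i 0.
have hB : B \is hermsymmx := compression_hermitian L H0s.
have HE w : box_hamiltonian L H0 (alloy_potential u (fun k => omega k w)) =
    diag_family B C (fun j => omega (box_pt j) w).
  rewrite /box_hamiltonian /diag_family; congr (_ + diag_mx _).
  by apply/rowP => i; rewrite !mxE (alloy_potential_box un0 _ _ n0n).
rewrite expectation.unlock; under eq_integral do rewrite HE.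
have Cr j : (#|[pred i | (C j i != 0)%R]| <= pot_rank u)%N.
  exact: (card_site_potential un0).
have a1 i : \sum_j alloy_weight u J (box_pt j) * C j i = 1.
  exact: (sum_alloy_weight un0).
have indep := mutually_independent_inj (@box_pt_inj d (L + n)) om_indep.
have := wegner_diag_family indep fd (fun i => om_f (box_pt i)) fV hB Cr a1 E eps0.
move=> /le_trans; apply.
rewrite VE -!EFinM lee_fin.
have := sum_norm_alloy_weight L n0n n_gt0 mJ'.
set S := \sum_j _; set K := _ ^+ (d * n.+1); set m := `|_| => SK.
have -> : 3 * 2 ^+ d / m * (pot_rank u)%:R * V * eps * K =
   (pot_rank u)%:R * (3 * eps * (2 ^+ d / m * K) * V) by ring.
have V0 : 0 <= V by exact: fine_ge0.
apply: ler_wpM2l => //; apply: ler_wpM2r => //; apply: ler_wpM2l => //.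
by rewrite mulr_ge0// ltW.
Qed.
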